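(* Let $p:\mathscr{A}\to G$ be a Fell bundle over a groupoid $G$, let $G$ act on itself by left translation, and let $\mathscr{A}\rtimes G$ be the corresponding action Fell bundle, equipped with the $G$-action $x\cdot(b,y)=(b,yx^{-1})$. Then the map $\mathscr{I}\mapsto\mathscr{I}\rtimes G$ is a lattice isomorphism from the lattice of ideals of $\mathscr{A}$ onto the lattice of $G$-invariant ideals of $\mathscr{A}\rtimes G$.
   Context: All groupoids are locally compact Hausdorff with open range and source maps $r,s$; $G^{(0)}$ is the unit space. Banach bundles may have a norm that is only upper semicontinuous. Fell bundle. A Fell bundle $p:\mathscr{B}\to G$ over a groupoid $G$ is a Banach bundle with a continuous, fibrewise bilinear, associative multiplication $(b,c)\mapsto bc$ defined on $\mathscr{B}^{(2)}=\{(b,c): s(p(b))=r(p(c))\}$ with $p(bc)=p(b)p(c)$ and $\|bc\|\le\|b\|\|c\|$, and a continuous, fibrewise conjugate-linear involution $b\mapsto b^*$ with $p(b^* )=p(b)^{-1}$, $(bc)^*=c^*b^*$, $b^{**}=b$, such that each fibre $B_u$ ($u\in G^{(0)}$) is a $C^*$-algebra and each fibre $B_x$ is a $B_{r(x)}$--$B_{s(x)}$ imprimitivity bimodule with inner products $bc^*$ (left) and $b^*c$ (right). (In particular all Fell bundles are saturated.) Ideals. A Fell subbundle of $\mathscr{B}$ is a subset meeting each fibre in a closed linear subspace, which is a Banach bundle in the relative topology and is closed under multiplication and involution. An ideal of $\mathscr{B}$ is a Fell subbundle $\mathscr{I}$ such that $bc\in\mathscr{I}$ whenever $(b,c)\in\mathscr{B}^{(2)}$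 and either $b\in\mathscr{I}$ or $c\in\mathscr{I}$. Ideals are ordered by inclusion. Action product. The action groupoid for left translation of $G$ on itself is $G\rtimes G=\{(x,y)\in G\times G: s(x)=r(y)\}$ with $(x,zy)(z,y)=(xz,y)$ and $(x,y)^{-1}=(x^{-1},xy)$; its unit space is identified with $G$, with source $(x,y)\mapsto y$ and range $(x,y)\mapsto xy$. The action Fell bundle is $\mathscr{A}\rtimes G=\{(a,y)\in\mathscr{A}\times G: s(p(a))=r(y)\}$ over $G\rtimes G$, with projection $(a,y)\mapsto(p(a),y)$, norm $\|(a,y)\|=\|a\|$, operations $(a,p(b)y)(b,y)=(ab,y)$ and $(a,y)^*=(a^*,p(a)y)$. The groupoid $G$ acts on $\mathscr{A}\rtimes G$ by $x\cdot(b,y)=(b,yx^{-1})$ for $s(x)=s(y)$ (moment map $(b,y)\mapsto s(y)$), covering the action $x\cdot(g,y)=(g,yx^{-1})$ on $G\rtimes G$. An ideal $\mathscr{J}$ of $\mathscr{A}\rtimes G$ is $G$-invariant if $x\cdot j\in\mathscr{J}$ whenever $j\in\mathscr{J}$ and $x\cdot j$ is defined. For an ideal $\mathscr{I}$ of $\mathscr{A}$, $\mathscr{I}\rtimes G=\{(i,y)\in\mathscr{A}\rtimes G: i\in\mathscr{I}\}$. *)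

(* Defs.v *)
From HB Require Import structures.
From mathcomp Require Import all_boot all_order all_algebra.
From mathcomp Require Import complex.
From mathcomp Require Import all_classical all_reals topology normedtype.

Set Implicit Arguments.
Unset Strict Implicit.
Unset Printing Implicit Defensive.

Import Order.TTheory GRing.Theory Num.Theory.
Import numFieldNormedType.Exports.

Local Open Scope classical_set_scope.
Local Open Scope ring_scope.

(* The unit space is a separate space [gobj], embedded in the groupoid by
   [gunit]; the product takes a proof of composability.  Since [gunit] is a
   continuous section of [grng], it is a homeomorphism onto its image. *)
Record groupoid := Groupoid {
  garr :> topologicalType;
  gobj : topologicalType;
  gsrc : garr -> gobj;
  grng : garr -> gobj;
  gunit : gobj -> garr;
  gmul : forall x y : garr, gsrc x = grng y -> garr;
  ginv : garr -> garr;
  gsrc_unit : forall u, gsrc (gunit u) = u;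
  grng_unit : forall u, grng (gunit u) = u;
  gsrc_mul : forall x y (h : gsrc x = grng y), gsrc (gmul h) = gsrc y;
  grng_mul : forall x y (h : gsrc x = grng y), grng (gmul h) = grng x;
  gsrc_inv : forall x, gsrc (ginv x) = grng x;
  grng_inv : forall x, grng (ginv x) = gsrc x;
  gmulA : forall x y z (xy : gsrc x = grng y) (yz : gsrc y = grng z)
    (xy_z : gsrc (gmul xy) = grng z) (x_yz : gsrc x = grng (gmul yz)),
    gmul xy_z = gmul x_yz;
  gmul1g : forall x (h : gsrc (gunit (grng x)) = grng x), gmul h = x;
  gmulg1 : forall x (h : gsrc x = grng (gunit (gsrc x))), gmul h = x;
  gmulgV : forall x (h : gsrc x = grng (ginv x)), gmul h = gunit (grng x);
  gmulVg : forall x (h : gsrc (ginv x) = grng x), gmul h = gunit (gsrc x);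
  gsrc_continuous : continuous gsrc;
  grng_continuous : continuous grng;
  gunit_continuous : continuous gunit;
  ginv_continuous : continuous ginv;
  gmul_continuous :
    continuous (fun xy : [set xy : garr * garr | gsrc xy.1 = grng xy.2] =>
                  gmul (set_mem (valP xy)));
  groupoid_hausdorff : hausdorff_space garr;
  groupoid_locally_compact : locally_compact [set: garr];
  gsrc_open : forall U : set garr, open U -> open (gsrc @` U);
  grng_open : forall U : set garr, open U -> open (grng @` U)
}.
Arguments gmul {g x y} _.
Arguments gmulA {g x y z} xy yz xy_z x_yz.
Arguments gsrc {g} _.
Arguments grng {g} _.
Arguments ginv {g} _.
Arguments gunit {g} _.

Record tot (X : Type) (F : X -> Type) := Tot { tbase : X; tvec : F tbase }.
Arguments Tot {X F} tbase tvec.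

Definition recast (X : Type) (F : X -> Type) (x y : X) (e : x = y) (v : F x) :
  F y := ecast z (F z) e v.

Section Bundles.
Variables (R : realType) (X : topologicalType).

(* A topological space in bijection with the disjoint union of a family of
   complex Banach spaces. *)
Record bundle := Bundle {
  bspace :> topologicalType;
  bfib : X -> completeNormedModType R[i];
  bel : bspace -> tot bfib;
  bmk : tot bfib -> bspace;
  belK : cancel bel bmk;
  bmkK : cancel bmk bel
}.

Variable B : bundle.

Definition bpt (x : X) (v : bfib B x) : B := bmk (@Tot X (bfib B) x v).

Definition bproj (b : B) : X := tbase (bel b).
Definition bvec (b : B) : bfib B (bproj b) := tvec (bel b).
(* The norm of the library is valued in the nonnegative reals of [R[i]]. *)
Definition bnorm (b : B) : R := complex.Re `|bvec b|.
Definition bzero (x : X) : B := bpt (0 : bfib B x).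
Definition bscale (l : R[i]) (b : B) : B := bpt (l *: bvec b).
Definition badd (b c : B) (h : bproj b = bproj c) : B :=
  bpt (recast (F := bfib B) h (bvec b) + bvec c).

Definition linear_subspace (V : lmodType R[i]) (S : set V) :=
  S 0 /\ forall (l : R[i]) u v, S u -> S v -> S (l *: u + v).

(* The subset [S], with the relative topology and with fibres the sets of all
   [v] in [bfib B x] such that [bpt v] belongs to [S], is an upper
   semicontinuous Banach bundle over [X]; nets are replaced by filters. *)
Record banach_subbundle (S : set B) : Prop := BanachSubbundle {
  bs_fibre : forall x, let Sx := [set v : bfib B x | S (bpt v)] in
    linear_subspace Sx /\ closed Sx;
  bs_proj_continuous : {within S, continuous bproj};
  bs_proj_open : forall U : set B, open U -> open (bproj @` (S `&` U));
  bs_proj_surj : bproj @` S = setT;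
  bs_norm_usc : forall e : R, exists2 U : set B, open U &
    S `&` [set b | bnorm b < e] = S `&` U;
  bs_add_continuous :
    continuous (fun bc : [set bc : B * B | (S bc.1 /\ S bc.2) /\
                                           bproj bc.1 = bproj bc.2] =>
                  badd (proj2 (set_mem (valP bc))));
  bs_scale_continuous : forall l, {within S, continuous (bscale l)};
  bs_zero_nbhs : forall (N : set_system B) (x : X), ProperFilter N -> N S ->
    bproj @ N --> x -> bnorm @ N --> (0 : R) -> N --> bzero x
}.

Definition banach_bundle := banach_subbundle setT.

End Bundles.
Arguments bproj {R X B} b.
Arguments bvec {R X B} b.
Arguments bmk {R X b} _.
Arguments bel {R X b} _.
Arguments bnorm {R X B} b.

Section Cstar.
Variable R : realType.
Implicit Types A B X : completeNormedModType R[i].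

Definition conj_linear (U V : lmodType R[i]) (f : U -> V) :=
  forall (l : R[i]) u v, f (l *: u + v) = l^* *: f u + f v.

Record cstar_algebra A (mul : A -> A -> A) (star : A -> A) : Prop := {
  cs_bilinear : bilinear_for *:%R *:%R mul;
  cs_mulA : associative mul;
  cs_norm_mul : forall a b, `|mul a b| <= `|a| * `|b|;
  cs_star_linear : conj_linear star;
  cs_starK : involutive star;
  cs_star_mul : forall a b, star (mul a b) = mul (star b) (star a);
  cs_norm : forall a, `|mul (star a) a| = `|a| ^+ 2
}.

(* The positive elements of a C*-algebra are those of the form c^* c. *)
Definition cstar_pos A (mul : A -> A -> A) (star : A -> A) (a : A) :=
  exists c, a = mul (star c) c.

Definition dense_span A (S : set A) :=
  closure (smallest (@linear_subspace R A) S) = setT.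

(* A Hilbert module is complete for the norm |<x, x>|^(1/2): here this is the
   given norm of [X], which is complete by the type of [X]. *)
Record full_left_hilbert A (mulA : A -> A -> A) (starA : A -> A)
    X (act : A -> X -> X) (ip : X -> X -> A) : Prop := {
  lh_act_bilinear : bilinear_for *:%R *:%R act;
  lh_actA : forall a b x, act (mulA a b) x = act a (act b x);
  lh_ip_linear : forall y, linear (ip^~ y);
  lh_ip_act : forall a x y, ip (act a x) y = mulA a (ip x y);
  lh_ip_star : forall x y, starA (ip x y) = ip y x;
  lh_ip_pos : forall x, cstar_pos mulA starA (ip x x);
  lh_ip_def : forall x, ip x x = 0 -> x = 0;
  lh_norm : forall x, `|ip x x| = `|x| ^+ 2;
  lh_full : dense_span [set ip xy.1 xy.2 | xy in [set: X * X]]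
}.

Record full_right_hilbert B (mulB : B -> B -> B) (starB : B -> B)
    X (act : X -> B -> X) (ip : X -> X -> B) : Prop := {
  rh_act_bilinear : bilinear_for *:%R *:%R act;
  rh_actA : forall x a b, act x (mulB a b) = act (act x a) b;
  rh_ip_linear : forall x, linear (ip x);
  rh_ip_act : forall x y b, ip x (act y b) = mulB (ip x y) b;
  rh_ip_star : forall x y, starB (ip x y) = ip y x;
  rh_ip_pos : forall x, cstar_pos mulB starB (ip x x);
  rh_ip_def : forall x, ip x x = 0 -> x = 0;
  rh_norm : forall x, `|ip x x| = `|x| ^+ 2;
  rh_full : dense_span [set ip xy.1 xy.2 | xy in [set: X * X]]
}.

Record imprimitivity_bimodule
    A (mulA : A -> A -> A) (starA : A -> A)
    B (mulB : B -> B -> B) (starB : B -> B)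
    X (lact : A -> X -> X) (ract : X -> B -> X)
    (lip : X -> X -> A) (rip : X -> X -> B) : Prop := {
  ib_left : full_left_hilbert mulA starA lact lip;
  ib_right : full_right_hilbert mulB starB ract rip;
  ib_actA : forall a x b, ract (lact a x) b = lact a (ract x b);
  ib_lact_adj : forall a x y, rip (lact a x) y = rip x (lact (starA a) y);
  ib_ract_adj : forall x b y, lip (ract x b) y = lip x (ract y (starB b));
  ib_ip : forall x y z, lact (lip x y) z = ract x (rip y z)
}.

End Cstar.

Section GroupoidUnits.
Variable G : groupoid.
Implicit Types (x y : G) (u : gobj G).

Lemma comp_unit u : gsrc (gunit u : G) = grng (gunit u : G).
Proof. by rewrite gsrc_unit grng_unit. Qed.

Lemma comp_rng x : gsrc (gunit (grng x)) = grng x.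
Proof. exact: gsrc_unit. Qed.

Lemma comp_src x : gsrc x = grng (gunit (gsrc x)).
Proof. by rewrite grng_unit. Qed.

Lemma comp_inv x : gsrc x = grng (ginv x).
Proof. by rewrite grng_inv. Qed.

Lemma inv_comp x : gsrc (ginv x) = grng x.
Proof. exact: gsrc_inv. Qed.

Lemma gmul_congr x y x' y' (h : gsrc x = grng y) (h' : gsrc x' = grng y') :
  x = x' -> y = y' -> gmul h = gmul h'.
Proof. by move=> ex ey; subst x' y'; congr gmul; exact: eq_irrelevance. Qed.

Lemma gmul_unit u : gmul (comp_unit u) = gunit u.
Proof.
rewrite -[RHS](gmul1g (comp_rng (gunit u))).
by apply: gmul_congr; rewrite ?grng_unit.
Qed.

Lemma ginv_unit u : ginv (gunit u) = gunit u :> G.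
Proof.
rewrite -(gmul1g (comp_rng (ginv (gunit u)))).
transitivity (gmul (comp_inv (gunit u : G))); last by rewrite gmulgV grng_unit.
by apply: gmul_congr; rewrite ?grng_inv ?gsrc_unit.
Qed.

End GroupoidUnits.

Section Fell.
Variables (R : realType) (G : groupoid).

Record fell_data := FellData {
  fbundle :> bundle R G;
  fmul : forall x y (h : gsrc x = grng y),
    bfib fbundle x -> bfib fbundle y -> bfib fbundle (gmul h);
  fstar : forall x, bfib fbundle x -> bfib fbundle (ginv x)
}.

Variable B : fell_data.
Local Notation fib := (bfib B).

Definition bmul (b c : B) (h : gsrc (bproj b) = grng (bproj c)) : B :=
  bpt (fmul h (bvec b) (bvec c)).
Definition bstar (b : B) : B := bpt (fstar (bvec b)).

(* The products [b c], [b c^*] and [b^* c] in [fell_cstar] and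
   [fell_imprimitivity] lie in fibres such as the one over [x x^-1], equal but
   not convertible to the one over the unit: they are transported. *)
Definition fmul_to (x y z : G) (h : gsrc x = grng y) (e : gmul h = z)
  (b : fib x) (c : fib y) : fib z := recast (F := fib) e (fmul h b c).
Definition fstar_to (x z : G) (e : ginv x = z) (b : fib x) : fib z :=
  recast (F := fib) e (fstar b).

Definition unit_mul (u : gobj G) : fib (gunit u) -> fib (gunit u) ->
  fib (gunit u) := fmul_to (gmul_unit u).
Definition unit_star (u : gobj G) : fib (gunit u) -> fib (gunit u) :=
  fstar_to (ginv_unit u).

Definition fib_lact (x : G) : fib (gunit (grng x)) -> fib x -> fib x :=
  fmul_to (gmul1g (comp_rng x)).
Definition fib_ract (x : G) : fib x -> fib (gunit (gsrc x)) -> fib x :=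
  fmul_to (gmulg1 (comp_src x)).
Definition fib_lip (x : G) (b c : fib x) : fib (gunit (grng x)) :=
  fmul_to (gmulgV (comp_inv x)) b (fstar c).
Definition fib_rip (x : G) (b c : fib x) : fib (gunit (gsrc x)) :=
  fmul_to (gmulVg (inv_comp x)) (fstar b) c.

Record is_fell : Prop := {
  fell_banach : banach_bundle B;
  fell_mul_bilinear : forall x y (h : gsrc x = grng y),
    bilinear_for *:%R *:%R (fmul h : fib x -> fib y -> fib (gmul h));
  fell_mulA : forall x y z (xy : gsrc x = grng y) (yz : gsrc y = grng z)
    (xy_z : gsrc (gmul xy) = grng z) (x_yz : gsrc x = grng (gmul yz))
    (b : fib x) (c : fib y) (d : fib z),
    bpt (fmul xy_z (fmul xy b c) d) = bpt (fmul x_yz b (fmul yz c d));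
  fell_norm_mul : forall x y (h : gsrc x = grng y) (b : fib x) (c : fib y),
    `|fmul h b c| <= `|b| * `|c|;
  fell_mul_continuous :
    continuous (fun bc : [set bc : B * B | gsrc (bproj bc.1) =
                                           grng (bproj bc.2)] =>
                  bmul (set_mem (valP bc)));
  fell_star_linear : forall x,
    conj_linear (@fstar B x : fib x -> fib (ginv x));
  fell_star_mul : forall x y (h : gsrc x = grng y)
    (h' : gsrc (ginv y) = grng (ginv x)) (b : fib x) (c : fib y),
    bpt (fstar (fmul h b c)) = bpt (fmul h' (fstar c) (fstar b));
  fell_starK : forall x (b : fib x), bpt (fstar (fstar b)) = bpt b;
  fell_star_continuous : continuous bstar;
  fell_cstar : forall u, cstar_algebra (unit_mul (u := u)) (unit_star (u := u));
  fell_imprimitivity : forall x, imprimitivity_bimodule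
    (unit_mul (u := grng x)) (unit_star (u := grng x))
    (unit_mul (u := gsrc x)) (unit_star (u := gsrc x))
    (fib_lact (x := x)) (fib_ract (x := x))
    (fib_lip (x := x)) (fib_rip (x := x))
}.

Record fell_subbundle (S : set B) : Prop := {
  fs_banach : banach_subbundle S;
  fs_mul : forall b c (h : gsrc (bproj b) = grng (bproj c)),
    S b -> S c -> S (bmul h);
  fs_star : forall b, S b -> S (bstar b)
}.

Record fell_ideal (I : set B) : Prop := {
  fi_subbundle : fell_subbundle I;
  fi_mul : forall b c (h : gsrc (bproj b) = grng (bproj c)),
    I b \/ I c -> I (bmul h)
}.

End Fell.
Arguments fell_ideal {R G B} I.
Arguments is_fell {R G} B.

Record fellBundle (R : realType) (G : groupoid) := FellBundle {
  fell_dataOf :> fell_data R G;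
  fellP : is_fell fell_dataOf
}.

Lemma locally_compactTP (T : topologicalType) :
  locally_compact [set: T] <->
  forall x : T, exists2 K, nbhs x K & compact K /\ closed K.
Proof.
split=> lT x.
  have [K xK Kc] := lT x I; exists K => //.
  by apply: (@filterS _ (nbhs x) _ _ K) xK => y; exact.
move=> _; have [K xK Kc] := lT x; exists K => //.
by apply: (@filterS _ (nbhs x) _ K) xK => y Ky _.
Qed.

Section SubtypeTopology.
Variables (T U : topologicalType) (A : set U).

Lemma val_continuous : continuous (fun z : A => val z).
Proof. exact: (@initial_continuous _ _ (@set_val U A)). Qed.

Lemma into_subtype_continuous (f : T -> A) :
  continuous (fun t => val (f t)) -> continuous f.
Proof. by move=> cf; apply: continuous_comp_initial. Qed.

Lemma subtype_hausdorff : hausdorff_space U -> hausdorff_space A.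
Proof.
move=> HU x y xy; apply/val_inj/HU => P Q Px Qy.
have [z [Pz Qz]] := xy _ _ (val_continuous Px) (val_continuous Qy).
by exists (val z).
Qed.

Lemma subtype_compact (K : set U) :
  closed A -> compact K -> compact [set z : A | K (val z)].
Proof.
move=> cA cK F PF FK.
have [p [Kp cp]] := cK ((fun z : A => val z) @ F) _ FK.
have Ap : A p.
  apply: cA => V Vp.
  have FA : ((fun z : A => val z) @ F) A.
    apply: (@filterE _ F) => z; exact: (set_mem (valP z)).
  by have [q [Aq Vq]] := cp _ _ FA Vp; exists q.
exists (exist _ p (mem_set Ap)); split => // P V FP.
case=> _ [[W oW <-] /= Wp sWV].
have FP' : ((fun z : A => val z) @ F) ((fun z : A => val z) @` P).
  by apply: (@filterS _ F _ P) FP => z Pz; exists z.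
have [q [[z Pz <-] Wz]] := cp _ _ FP' (open_nbhs_nbhs (conj oW Wp)).
by exists z; split => //; exact: sWV.
Qed.

Lemma subtype_locally_compact :
  closed A -> locally_compact [set: U] -> locally_compact [set: A].
Proof.
move=> cA /locally_compactTP lU; apply/locally_compactTP => z.
have [K zK [cK clK]] := lU (val z).
exists [set z : A | K (val z)]; first exact: (val_continuous zK).
split; first exact: subtype_compact.
by apply: preimage_closed clK => ? _; exact: val_continuous.
Qed.

End SubtypeTopology.

Lemma setX_hausdorff (T U : topologicalType) :
  hausdorff_space T -> hausdorff_space U -> hausdorff_space (T * U)%type.
Proof.
move=> HT HU [a b] [c d] cl; congr pair.
  apply: HT => P Q Pa Qc.
  have aP : nbhs (a, b) (P `*` setT) by exists (P, setT) => //; split => //; exact: filterT.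
  have cQ : nbhs (c, d) (Q `*` setT) by exists (Q, setT) => //; split => //; exact: filterT.
  by have [[x y] [[? _] [? _]]] := cl _ _ aP cQ; exists x.
apply: HU => P Q Pb Qd.
have bP : nbhs (a, b) (setT `*` P) by exists (setT, P) => //; split => //; exact: filterT.
have dQ : nbhs (c, d) (setT `*` Q) by exists (setT, Q) => //; split => //; exact: filterT.
by have [[x y] [[_ ?] [_ ?]]] := cl _ _ bP dQ; exists y.
Qed.

Lemma setX_locally_compact (T U : topologicalType) :
  locally_compact [set: T] -> locally_compact [set: U] ->
  locally_compact [set: (T * U)%type].
Proof.
move=> /locally_compactTP lT /locally_compactTP lU.
apply/locally_compactTP => -[a b].
have [K aK [cK clK]] := lT a; have [L bL [cL clL]] := lU b.
exists (K `*` L); first by exists (K, L).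
split; first exact: compact_setX.
by apply: closedI; apply: preimage_closed => // ? _; [exact: cvg_fst|exact: cvg_snd].
Qed.

Lemma equalizer_closed (T U : topologicalType) (f g : T -> U) :
  hausdorff_space U -> continuous f -> continuous g ->
  closed [set t | f t = g t].
Proof.
move=> HU cf cg t clt; apply: HU => P Q Pf Qg.
have [s [/= fg [Ps Qs]]] := clt _ (@filterI _ (nbhs t) _ _ _ (cf t _ Pf) (cg t _ Qg)).
by exists (f s); split=> //; rewrite fg.
Qed.

Lemma pair_continuous (T U V : topologicalType) (f : T -> U) (g : T -> V) :
  continuous f -> continuous g -> continuous (fun t => (f t, g t)).
Proof. by move=> cf cg t; apply: cvg_pair; [exact: cf|exact: cg]. Qed.

Lemma comp_continuous (T U V : topologicalType) (g : U -> V) (f : T -> U) :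
  continuous g -> continuous f -> continuous (fun t => g (f t)).
Proof. by move=> cg cf t; apply: continuous_comp; [exact: cf|exact: cg]. Qed.

Section ActionGroupoid.
Variable G : groupoid.

Lemma gobj_hausdorff : hausdorff_space (gobj G).
Proof.
move=> u v cl; rewrite -(gsrc_unit u) -(gsrc_unit v); congr gsrc.
apply: (@groupoid_hausdorff G) => P Q Pu Qv.
have [w [Pw Qw]] := cl _ _ (@gunit_continuous G u _ Pu) (@gunit_continuous G v _ Qv).
by exists (gunit w).
Qed.

Definition comp_pairs : set (G * G) := [set xy | gsrc xy.1 = grng xy.2].

Implicit Types z w : comp_pairs.

Definition act_pt (x y : G) (h : gsrc x = grng y) : comp_pairs :=
  exist _ (x, y) (mem_set h).
Definition act1 z : G := (val z).1.
Definition act2 z : G := (val z).2.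

Lemma act_comp z : gsrc (act1 z) = grng (act2 z).
Proof. exact: (set_mem (valP z)). Qed.

(* The arrow (x, y) goes from y to xy; the space of units is G itself. *)
Definition act_src z : G := act2 z.
Definition act_rng z : G := gmul (act_comp z).
Definition act_unit (y : G) : comp_pairs :=
  act_pt (x := gunit (grng y)) (y := y) (comp_rng y).

Lemma act_mul_comp1 z w : act_src z = act_rng w -> gsrc (act1 z) = grng (act1 w).
Proof. by move=> h; rewrite act_comp -/(act_src z) h grng_mul. Qed.

Lemma act_mul_comp z w (h : act_src z = act_rng w) :
  gsrc (gmul (act_mul_comp1 h)) = grng (act2 w).
Proof. by rewrite gsrc_mul act_comp. Qed.

Definition act_mul z w (h : act_src z = act_rng w) : comp_pairs :=
  act_pt (x := gmul (act_mul_comp1 h)) (y := act2 w) (act_mul_comp h).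

Lemma act_inv_comp z : gsrc (ginv (act1 z)) = grng (act_rng z).
Proof. by rewrite gsrc_inv grng_mul. Qed.

Definition act_inv z : comp_pairs :=
  act_pt (x := ginv (act1 z)) (y := act_rng z) (act_inv_comp z).

Lemma act_ext z w : act1 z = act1 w -> act2 z = act2 w -> z = w.
Proof.
rewrite /act1 /act2 => e1 e2; apply: val_inj.
by rewrite [LHS]surjective_pairing e1 e2 -surjective_pairing.
Qed.

Lemma act1_continuous : continuous act1.
Proof. apply: (@comp_continuous _ _ _ fst); [exact: (fun _ => cvg_fst)|exact: val_continuous]. Qed.

Lemma act2_continuous : continuous act2.
Proof. apply: (@comp_continuous _ _ _ snd); [exact: (fun _ => cvg_snd)|exact: val_continuous]. Qed.

Lemma gmul_continuous_comp (T : topologicalType) (f g : T -> G)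
    (h : forall t, gsrc (f t) = grng (g t)) :
  continuous f -> continuous g -> continuous (fun t => gmul (h t)).
Proof.
move=> cf cg.
have -> : (fun t => gmul (h t)) =
    (fun xy : comp_pairs => gmul (set_mem (valP xy))) \o (fun t => act_pt (h t)).
  by apply/funext => t /=; apply: gmul_congr.
apply: (@comp_continuous _ _ _ (fun xy : comp_pairs => gmul (set_mem (valP xy)))).
  exact: (@gmul_continuous G).
by apply: into_subtype_continuous; exact: pair_continuous.
Qed.

Lemma act_pt_continuous (T : topologicalType) (f g : T -> G)
    (h : forall t, gsrc (f t) = grng (g t)) :
  continuous f -> continuous g -> continuous (fun t => act_pt (h t)).
Proof. by move=> cf cg; apply: into_subtype_continuous; exact: pair_continuous. Qed.

Lemma act_rng_continuous : continuous act_rng.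
Proof. exact: gmul_continuous_comp act1_continuous act2_continuous. Qed.

Lemma act_unit_continuous : continuous act_unit.
Proof.
apply: act_pt_continuous; last by move=> x; exact: cvg_id.
by apply: comp_continuous; [exact: gunit_continuous|exact: grng_continuous].
Qed.

Lemma act_inv_continuous : continuous act_inv.
Proof.
apply: act_pt_continuous; last exact: act_rng_continuous.
by apply: comp_continuous; [exact: ginv_continuous|exact: act1_continuous].
Qed.

Lemma act_mul_continuous :
  continuous (fun zw : [set zw : comp_pairs * comp_pairs |
                         act_src zw.1 = act_rng zw.2] =>
                act_mul (set_mem (valP zw))).
Proof.
have c1 : continuous (fun zw : [set zw : comp_pairs * comp_pairs |
    act_src zw.1 = act_rng zw.2] => (val zw).1).
  by apply: (@comp_continuous _ _ _ fst);
    [exact: (fun _ => cvg_fst)|exact: val_continuous].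
have c2 : continuous (fun zw : [set zw : comp_pairs * comp_pairs |
    act_src zw.1 = act_rng zw.2] => (val zw).2).
  by apply: (@comp_continuous _ _ _ snd);
    [exact: (fun _ => cvg_snd)|exact: val_continuous].
apply: act_pt_continuous; last exact: (comp_continuous act2_continuous c2).
apply: gmul_continuous_comp; first exact: (comp_continuous act1_continuous c1).
exact: (comp_continuous act1_continuous c2).
Qed.

Lemma act_src_unit y : act_src (act_unit y) = y.
Proof. by []. Qed.

Lemma act_rng_unit y : act_rng (act_unit y) = y.
Proof. by rewrite /act_rng; rewrite -[RHS](gmul1g (comp_rng y)); exact: gmul_congr. Qed.

Lemma act_src_mul z w (h : act_src z = act_rng w) :
  act_src (act_mul h) = act_src w.
Proof. by []. Qed.

Lemma act_rng_mul z w (h : act_src z = act_rng w) :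
  act_rng (act_mul h) = act_rng z.
Proof.
have k : gsrc (act1 z) = grng (gmul (act_comp w)) by rewrite grng_mul; exact: act_mul_comp1 h.
rewrite /act_rng (gmulA (act_mul_comp1 h) (act_comp w) (act_comp (act_mul h)) k).
by apply: gmul_congr => //; rewrite -[RHS]/(act_src z) h.
Qed.

Lemma act_src_inv z : act_src (act_inv z) = act_rng z.
Proof. by []. Qed.

Lemma act_rng_inv z : act_rng (act_inv z) = act_src z.
Proof.
have k : gsrc (gmul (inv_comp (act1 z))) = grng (act2 z).
  by rewrite gmulVg gsrc_unit act_comp.
rewrite /act_rng -(gmulA (inv_comp (act1 z)) (act_comp z) k (act_comp (act_inv z))).
rewrite -[RHS](gmul1g (comp_rng (act2 z))).
by apply: gmul_congr => //; rewrite gmulVg act_comp.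
Qed.

Lemma act_mulA x y z (xy : act_src x = act_rng y) (yz : act_src y = act_rng z)
    (xy_z : act_src (act_mul xy) = act_rng z)
    (x_yz : act_src x = act_rng (act_mul yz)) :
  act_mul xy_z = act_mul x_yz.
Proof. by apply: act_ext => //; exact: gmulA. Qed.

Lemma act_mul1g x (h : act_src (act_unit (act_rng x)) = act_rng x) :
  act_mul h = x.
Proof.
apply: act_ext => //; rewrite -[RHS](gmul1g (comp_rng (act1 x))).
by apply: gmul_congr => //=; rewrite /act1/= grng_mul.
Qed.

Lemma act_mulg1 x (h : act_src x = act_rng (act_unit (act_src x))) :
  act_mul h = x.
Proof.
apply: act_ext => //; rewrite -[RHS](gmulg1 (comp_src (act1 x))).
by apply: gmul_congr => //=; rewrite act_comp.
Qed.

Lemma act_mulgV x (h : act_src x = act_rng (act_inv x)) :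
  act_mul h = act_unit (act_rng x).
Proof.
apply: act_ext => //.
transitivity (gmul (comp_inv (act1 x))); first exact: gmul_congr.
by rewrite gmulgV -[RHS]/(gunit (grng (act_rng x))) grng_mul.
Qed.

Lemma act_mulVg x (h : act_src (act_inv x) = act_rng x) :
  act_mul h = act_unit (act_src x).
Proof.
apply: act_ext => //.
transitivity (gmul (inv_comp (act1 x))); first exact: gmul_congr.
by rewrite gmulVg -[RHS]/(gunit (grng (act2 x))) act_comp.
Qed.

Lemma comp_pairs_closed : closed comp_pairs.
Proof.
apply: equalizer_closed; first exact: gobj_hausdorff.
  by apply: (comp_continuous (@gsrc_continuous G)) => ?; exact: cvg_fst.
by apply: (comp_continuous (@grng_continuous G)) => ?; exact: cvg_snd.
Qed.

Lemma act_src_open (U : set comp_pairs) : open U -> open (act_src @` U).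
Proof.
case=> W oW <-; rewrite openE => _ [z /= Wz <-].
have /= [[P Q] /= [Pz Qz] sPQ] : nbhs (val z) W by exact: open_nbhs_nbhs.
move: Pz; rewrite nbhsE => -[P' [oP' P'z sP']].
have nP : nbhs (grng (act2 z)) (gsrc @` P').
  apply: open_nbhs_nbhs; split; first exact: gsrc_open.
  by exists (act1 z) => //; exact: act_comp.
have nI := @filterI _ (nbhs (act2 z)) _ _ _ Qz (@grng_continuous G (act2 z) _ nP).
apply: filterS (nI _) => //.
move=> y [Qy [x P'x e]]; exists (act_pt e) => //=.
by apply: sPQ; split => //=; exact: sP'.
Qed.

Lemma act_rng_open (U : set comp_pairs) : open U -> open (act_rng @` U).
Proof.
move=> oU; have -> : act_rng @` U = act_src @` (act_inv @^-1` U).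
  have invK z : act_inv (act_inv z) = z.
    apply: act_ext; last by rewrite -[LHS]/(act_rng (act_inv z)) act_rng_inv.
    rewrite -[LHS]/(ginv (ginv (act1 z))).
    set x := act1 z.
    have c1 : gsrc x = grng (ginv x) := comp_inv x.
    have c2 : gsrc (ginv x) = grng (ginv (ginv x)) := comp_inv _.
    have c12 : gsrc (gmul c1) = grng (ginv (ginv x)).
      by rewrite gsrc_mul c2.
    have c21 : gsrc x = grng (gmul c2) by rewrite grng_mul.
    have := gmulA c1 c2 c12 c21.
    have -> : gmul c12 = ginv (ginv x).
      rewrite -[RHS](gmul1g (comp_rng _)); apply: gmul_congr => //.
      by rewrite gmulgV !grng_inv gsrc_inv.
    move=> ->; rewrite -[RHS](gmulg1 (comp_src x)); apply: gmul_congr => //.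
    by rewrite gmulgV grng_inv.
  apply/seteqP; split=> y [z Uz <-].
    by exists (act_inv z) => //=; rewrite invK.
  by exists (act_inv z) => //; rewrite act_rng_inv.
by apply: act_src_open; apply: open_comp oU => ? _; exact: act_inv_continuous.
Qed.

Definition action_groupoid : groupoid := @Groupoid
  comp_pairs G act_src act_rng act_unit act_mul act_inv
  act_src_unit act_rng_unit act_src_mul act_rng_mul act_src_inv act_rng_inv
  act_mulA act_mul1g act_mulg1 act_mulgV act_mulVg
  act2_continuous act_rng_continuous act_unit_continuous act_inv_continuous
  act_mul_continuous
  (subtype_hausdorff (setX_hausdorff (@groupoid_hausdorff G) (@groupoid_hausdorff G)))
  (subtype_locally_compact comp_pairs_closed
    (setX_locally_compact (@groupoid_locally_compact G)
                          (@groupoid_locally_compact G)))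
  act_src_open act_rng_open.

End ActionGroupoid.

Section TotalSpace.
Variables (R : realType) (X : topologicalType) (B : bundle R X).

Lemma bel_pt x (v : bfib B x) : bel (bpt v) = @Tot X (bfib B) x v.
Proof. exact: bmkK. Qed.

Lemma bproj_pt x (v : bfib B x) : bproj (bpt v) = x.
Proof. by rewrite /bproj bel_pt. Qed.

Lemma bpt_vec (b : B) : bpt (bvec b) = b.
Proof. by rewrite -[RHS]belK /bpt /bvec /bproj; case: (bel b). Qed.

End TotalSpace.

Section ActionFell.
Variables (R : realType) (G : groupoid) (A : fell_data R G).

Local Notation H := (action_groupoid G).

Definition act_space : set (A * G) :=
  [set ay | gsrc (bproj ay.1) = grng ay.2].

Implicit Types j : act_space.

Definition act_fst j : A := (val j).1.
Definition act_snd j : G := (val j).2.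

Lemma act_space_comp j : gsrc (bproj (act_fst j)) = grng (act_snd j).
Proof. exact: (set_mem (valP j)). Qed.

Definition space_pt (a : A) (y : G) (h : gsrc (bproj a) = grng y) : act_space :=
  exist _ (a, y) (mem_set h).

(* The fibre of the action bundle over (x, y) is the fibre of [A] over x. *)
Definition act_fib (z : H) : completeNormedModType R[i] := bfib A (act1 z).

Definition act_el j : tot act_fib :=
  @Tot H act_fib (act_pt (act_space_comp j)) (bvec (act_fst j)).

Lemma act_mk_comp (z : H) (v : act_fib z) :
  gsrc (bproj (bpt (v : bfib A (act1 z)))) = grng (act2 z).
Proof. by rewrite bproj_pt; exact: act_comp. Qed.

Definition act_mk (t : tot act_fib) : act_space :=
  space_pt (a := bpt (tvec t : bfib A (act1 (tbase t)))) (y := act2 (tbase t))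
    (act_mk_comp (tvec t)).

Lemma act_elK : cancel act_el act_mk.
Proof.
move=> j; apply: val_inj.
change ((bpt (bvec (act_fst j)), act_snd j) = val j).
by rewrite bpt_vec /act_fst /act_snd -surjective_pairing.
Qed.

Lemma tot_ext (z w : H) (v : act_fib z) (v' : act_fib w) :
  @Tot G (bfib A) (act1 z) v = @Tot G (bfib A) (act1 w) v' ->
  act2 z = act2 w -> @Tot H act_fib z v = @Tot H act_fib w v'.
Proof.
move=> e e2; have e1 : act1 z = act1 w := congr1 (@tbase _ _) e.
have ezw := act_ext e1 e2; subst w; congr Tot.
have K (t : tot (bfib A)) (h : tbase t = act1 z) :
    @Tot G (bfib A) (act1 z) v = t -> v = recast (F := bfib A) h (tvec t).
  by move=> et; subst t => /=; rewrite (eq_irrelevance h erefl).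
exact: (K (@Tot G (bfib A) (act1 z) v') erefl e).
Qed.

Lemma act_mkK : cancel act_mk act_el.
Proof.
case=> z v; apply: tot_ext => //.
change (@Tot G (bfib A) (bproj (bpt (v : bfib A (act1 z)))) (bvec (bpt v)) =
  @Tot G (bfib A) (act1 z) v).
by rewrite -[RHS]bel_pt /bvec /bproj; case: (bel _).
Qed.

Definition action_bundle : bundle R H :=
  @Bundle R H act_space act_fib act_el act_mk act_elK act_mkK.

Definition act_fmul (z w : H) (h : gsrc z = grng w)
    (b : bfib action_bundle z) (c : bfib action_bundle w) :
    bfib action_bundle (gmul h) :=
  fmul (act_mul_comp1 h) (b : bfib A (act1 z)) (c : bfib A (act1 w)).

Definition act_fstar (z : H) (b : bfib action_bundle z) :
    bfib action_bundle (ginv z) :=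
  fstar (b : bfib A (act1 z)).

Definition action_data : fell_data R H :=
  @FellData R H action_bundle act_fmul act_fstar.

Lemma act_bptE (z : H) (v : bfib action_bundle z) :
  val (bpt v) = (bpt (v : bfib A (act1 z)), act2 z).
Proof. by []. Qed.

Lemma act_bpt_ext (z w : H) (v : bfib action_bundle z)
    (v' : bfib action_bundle w) :
  bpt (v : bfib A (act1 z)) = bpt (v' : bfib A (act1 w)) ->
  act2 z = act2 w -> bpt v = bpt v'.
Proof. by move=> e e2; apply: val_inj; rewrite !act_bptE e e2. Qed.

Lemma recast_act (z w : H) (e : z = w) (v : bfib action_bundle z) :
  recast (F := bfib action_bundle) e v =
  recast (F := bfib A) (congr1 (@act1 G) e) v.
Proof. by case: w / e. Qed.

Lemma recast_irr (x y : G) (e e' : x = y) (v : bfib A x) :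
  recast (F := bfib A) e v = recast (F := bfib A) e' v.
Proof. by rewrite (eq_irrelevance e e'). Qed.

Lemma act_fst_continuous : continuous act_fst.
Proof.
apply: (@comp_continuous _ _ _ fst); last exact: val_continuous.
by move=> ?; exact: cvg_fst.
Qed.

Lemma act_snd_continuous : continuous act_snd.
Proof.
apply: (@comp_continuous _ _ _ snd); last exact: val_continuous.
by move=> ?; exact: cvg_snd.
Qed.

Lemma space_pt_continuous (T : topologicalType) (f : T -> A) (g : T -> G)
    (h : forall t, gsrc (bproj (f t)) = grng (g t)) :
  continuous f -> continuous g -> continuous (fun t => space_pt (h t)).
Proof. by move=> cf cg; apply: into_subtype_continuous; exact: pair_continuous. Qed.

Hypothesis FA : is_fell A.

Lemma bproj_continuous : continuous (@bproj _ _ A).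
Proof. by apply/continuous_subspace_setT; exact: (bs_proj_continuous (fell_banach FA)). Qed.

Lemma bscale_continuous l : continuous (@bscale _ _ A l).
Proof. by apply/continuous_subspace_setT; exact: (bs_scale_continuous (fell_banach FA)). Qed.

Lemma badd_continuous (T : topologicalType) (f g : T -> A)
    (h : forall t, bproj (f t) = bproj (g t)) :
  continuous f -> continuous g -> continuous (fun t => badd (h t)).
Proof.
move=> cf cg.
pose S : set (A * A) := [set bc | ([set: A] bc.1 /\ [set: A] bc.2) /\
                                  bproj bc.1 = bproj bc.2].
have hS t : S (f t, g t) by split => //; exact: h.
have -> : (fun t => badd (h t)) =
    (fun bc : S => badd (proj2 (set_mem (valP bc)))) \o
    (fun t => exist _ (f t, g t) (mem_set (hS t)) : S).
  by apply/funext => t /=; congr badd; exact: eq_irrelevance.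
apply: (@comp_continuous _ _ _ (fun bc : S => badd (proj2 (set_mem (valP bc))))).
  exact: (bs_add_continuous (fell_banach FA)).
by apply: into_subtype_continuous; exact: pair_continuous.
Qed.

Lemma bmul_continuous (T : topologicalType) (f g : T -> A)
    (h : forall t, gsrc (bproj (f t)) = grng (bproj (g t))) :
  continuous f -> continuous g -> continuous (fun t => bmul (h t)).
Proof.
move=> cf cg.
pose S : set (A * A) := [set bc | gsrc (bproj bc.1) = grng (bproj bc.2)].
have -> : (fun t => bmul (h t)) =
    (fun bc : S => bmul (set_mem (valP bc))) \o
    (fun t => exist _ (f t, g t) (mem_set (h t)) : S).
  by apply/funext => t /=; congr bmul; exact: eq_irrelevance.
apply: (@comp_continuous _ _ _ (fun bc : S => bmul (set_mem (valP bc)))).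
  exact: (fell_mul_continuous FA).
by apply: into_subtype_continuous; exact: pair_continuous.
Qed.

Lemma val_fst_continuous (T U : topologicalType) (S : set (T * U)) :
  continuous (fun s : S => (val s).1).
Proof.
apply: (@comp_continuous _ _ _ fst); last exact: val_continuous.
by move=> ?; exact: cvg_fst.
Qed.

Lemma val_snd_continuous (T U : topologicalType) (S : set (T * U)) :
  continuous (fun s : S => (val s).2).
Proof.
apply: (@comp_continuous _ _ _ snd); last exact: val_continuous.
by move=> ?; exact: cvg_snd.
Qed.

Lemma act_proj_open (U : set action_bundle) :
  open U -> open (bproj @` (setT `&` U)).
Proof.
case=> W oW <-; rewrite openE => _ [j [_ Wj] <-].
have /= [[P Q] /= [Pj Qj] sPQ] : nbhs (val j) W by exact: open_nbhs_nbhs.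
move: Pj; rewrite nbhsE => -[P' [oP' P'j sP']].
have oP : open (bproj @` P').
  by rewrite -[P']setTI; exact: (bs_proj_open (fell_banach FA)).
have n1 : nbhs (bproj j) (@act1 G @^-1` (bproj @` P')).
  apply: act1_continuous; apply: open_nbhs_nbhs; split => //.
  by exists (act_fst j).
have n2 : nbhs (bproj j) (@act2 G @^-1` Q) by exact: act2_continuous.
apply: filterS (filterI n1 n2) => z [[a P'a ea] Qz].
have h : gsrc (bproj a) = grng (act2 z) by rewrite ea; exact: act_comp.
exists (space_pt h); last exact: act_ext.
by split => //; apply: sPQ; split => //; exact: sP'.
Qed.

Lemma action_banach : banach_bundle action_bundle.
Proof.
have BA := fell_banach FA.
split.
- by move=> z; split; [split|exact: closedT].
- apply: continuous_subspaceT.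
  change (continuous (fun j => act_pt (act_space_comp j))).
  apply: act_pt_continuous; last exact: act_snd_continuous.
  exact: (comp_continuous bproj_continuous act_fst_continuous).
- exact: act_proj_open.
- by apply/seteqP; split=> // z _; exists (bzero action_bundle z) => //; exact: bproj_pt.
- move=> e; have [U oU] := bs_norm_usc BA e; rewrite !setTI => eU.
  exists (act_fst @^-1` U); last first.
    rewrite !setTI -eU; by [].
  by apply: open_comp oU => ? _; exact: act_fst_continuous.
- set S := (X in set_type X).
  have h (bc : S) : bproj (act_fst (val bc).1) = bproj (act_fst (val bc).2).
    exact: (congr1 (@act1 G) (proj2 (set_mem (valP bc)))).
  have h' (bc : S) : gsrc (bproj (badd (h bc))) = grng (act_snd (val bc).2).
    by rewrite bproj_pt; exact: act_space_comp.
  rewrite (_ : (fun _ => _) = fun bc : S => space_pt (h' bc)); last first.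
    apply/funext => bc; apply: val_inj; rewrite act_bptE recast_act.
    congr pair; rewrite /badd; congr (bpt (_ + _)); exact: recast_irr.
  apply: space_pt_continuous.
    apply: badd_continuous; apply: comp_continuous act_fst_continuous _;
      [exact: val_fst_continuous|exact: val_snd_continuous].
  by apply: comp_continuous act_snd_continuous _; exact: val_snd_continuous.
- move=> l; apply: continuous_subspaceT.
  have h j : gsrc (bproj (bscale l (act_fst j))) = grng (act_snd j).
    by rewrite bproj_pt; exact: act_space_comp.
  rewrite (_ : @bscale _ _ action_bundle l = fun j => space_pt (h j)); last first.
    by apply/funext => j; apply: val_inj.
  apply: space_pt_continuous; last exact: act_snd_continuous.
  exact: (comp_continuous (bscale_continuous (l := l)) act_fst_continuous).
- move=> N z PN _ Nz N0.
  have N1 : act_fst @ N --> bzero A (act1 z).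
    apply: (bs_zero_nbhs BA) => //; first exact: filterT.
    apply: cvg_trans (cvg_comp _ _ Nz (@act1_continuous G z)).
    exact: cvg_id.
  have N2 : act_snd @ N --> act2 z.
    by apply: cvg_trans (cvg_comp _ _ Nz (@act2_continuous G z)); exact: cvg_id.
  move=> V [_ [[W oW <-] /= Wz sWV]].
  have nW : nbhs (bzero A (act1 z), act2 z) W by exact: open_nbhs_nbhs.
  have NW : N [set j | W (act_fst j, act_snd j)] by exact: (cvg_pair N1 N2 nW).
  apply: (@filterS _ N _ _ _ sWV); apply: filterS NW => j.
  by rewrite /= /act_fst /act_snd -surjective_pairing.
Qed.

Lemma fmul_to_irr (x y z : G) (h h' : gsrc x = grng y) (e : gmul h = z)
    (e' : gmul h' = z) :
  fmul_to e = fmul_to e' :> (bfib A x -> bfib A y -> bfib A z).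
Proof.
have eh : h = h' by exact: eq_irrelevance.
by subst h'; rewrite (eq_irrelevance e e').
Qed.

Lemma act_fmul_to (x y z : H) (h : gsrc x = grng y) (e : gmul h = z) :
  fmul_to (B := action_data) e =
  fmul_to (B := A) (congr1 (@act1 G) e : gmul (act_mul_comp1 h) = act1 z).
Proof. by apply/funext => b; apply/funext => c; rewrite /fmul_to recast_act. Qed.

Lemma act_unit_mul (u : G) :
  @unit_mul R H action_data u = @unit_mul R G A (grng u).
Proof. by rewrite /unit_mul act_fmul_to; exact: fmul_to_irr. Qed.

Lemma act_unit_star (u : G) :
  @unit_star R H action_data u = @unit_star R G A (grng u).
Proof.
apply/funext => b; rewrite /unit_star /fstar_to recast_act.
exact: recast_irr.
Qed.

Lemma imprimitivity_irr (x : G) (u v : gobj G) (hu : grng x = u) (hv : gsrc x = v)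
    h1 (e1 : @gmul G (gunit u) x h1 = x) h2 (e2 : @gmul G x (gunit v) h2 = x)
    h3 (e3 : @gmul G x (ginv x) h3 = gunit u)
    h4 (e4 : @gmul G (ginv x) x h4 = gunit v) :
  imprimitivity_bimodule
    (@unit_mul R G A u) (@unit_star R G A u)
    (@unit_mul R G A v) (@unit_star R G A v)
    (fmul_to e1) (fmul_to e2)
    (fun b c => fmul_to e3 b (fstar c)) (fun b c => fmul_to e4 (fstar b) c).
Proof.
subst u v; rewrite (fmul_to_irr e1 (gmul1g (comp_rng x))).
rewrite (fmul_to_irr e2 (gmulg1 (comp_src x))).
rewrite (fmul_to_irr e3 (gmulgV (comp_inv x))).
rewrite (fmul_to_irr e4 (gmulVg (inv_comp x))).
exact: (fell_imprimitivity FA x).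
Qed.

Lemma action_is_fell : is_fell action_data.
Proof.
split.
- exact: action_banach.
- by move=> z w h; exact: (fell_mul_bilinear FA (act_mul_comp1 h)).
- move=> x y z xy yz xy_z x_yz b c d; apply: act_bpt_ext => //.
  exact: (fell_mulA FA).
- by move=> z w h b c; exact: (fell_norm_mul FA).
- set S := (X in set_type X).
  have h (bc : S) : gsrc (bproj (act_fst (val bc).1)) =
                    grng (bproj (act_fst (val bc).2)).
    exact: (act_mul_comp1 (set_mem (valP bc))).
  have h' (bc : S) : gsrc (bproj (bmul (h bc))) = grng (act_snd (val bc).2).
    by rewrite bproj_pt gsrc_mul; exact: act_space_comp.
  rewrite (_ : (fun _ => _) = fun bc : S => space_pt (h' bc)); last first.
    apply/funext => bc; apply: val_inj; rewrite act_bptE; congr pair.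
    by rewrite /bmul; congr (bpt (fmul _ _ _)); exact: eq_irrelevance.
  apply: space_pt_continuous.
    apply: bmul_continuous; apply: comp_continuous act_fst_continuous _;
      [exact: val_fst_continuous|exact: val_snd_continuous].
  by apply: comp_continuous act_snd_continuous _; exact: val_snd_continuous.
- by move=> z; exact: (fell_star_linear FA).
- move=> z w h h' b c; apply: act_bpt_ext; first exact: (fell_star_mul FA).
  rewrite -[LHS]/(act_rng (act_mul h)) act_rng_mul.
  by rewrite -[RHS]/(act_rng z).
- move=> z b; apply: act_bpt_ext; first exact: (fell_starK FA).
  by rewrite -[LHS]/(act_rng (act_inv z)) act_rng_inv.
- have h (j : action_bundle) :
      gsrc (bproj (bstar (act_fst j))) = grng (act_rng (bproj j)).
    rewrite bproj_pt; exact: act_inv_comp (bproj j).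
  rewrite (_ : @bstar _ _ action_data = fun j => space_pt (h j)); last first.
    by apply/funext => j; exact: val_inj.
  apply: space_pt_continuous.
    exact: (comp_continuous (fell_star_continuous FA) act_fst_continuous).
  apply: (comp_continuous (@act_rng_continuous G)).
  by apply/continuous_subspace_setT; exact: (bs_proj_continuous action_banach).
- by move=> u; rewrite act_unit_mul act_unit_star; exact: (fell_cstar FA).
- move=> z; rewrite !act_unit_mul !act_unit_star.
  rewrite /fib_lact /fib_ract !act_fmul_to.
  rewrite (_ : @fib_lip _ _ action_data z = fun b c =>
    fmul_to (congr1 (@act1 G) (gmulgV (comp_inv z)) :
      gmul (act_mul_comp1 (comp_inv z)) = gunit (grng (act_rng z))) b (fstar c)); last first.
    by rewrite /fib_lip act_fmul_to.
  rewrite (_ : @fib_rip _ _ action_data z = fun b c =>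
    fmul_to (congr1 (@act1 G) (gmulVg (inv_comp z)) :
      gmul (act_mul_comp1 (inv_comp z)) = gunit (grng (act2 z))) (fstar b) c); last first.
    by rewrite /fib_rip act_fmul_to.
  apply: imprimitivity_irr; first by rewrite grng_mul.
  exact: act_comp.
Qed.

End ActionFell.

Definition action_fell (R : realType) (G : groupoid) (A : fellBundle R G) :
  fellBundle R (action_groupoid G) :=
  FellBundle (action_is_fell (fellP A)).

Section Invariant.
Variables (R : realType) (G : groupoid) (A : fellBundle R G).
Local Notation AG := (action_fell A).

Lemma translate_comp (x : G) (j : AG) (h : gsrc x = gsrc (act_snd j)) :
  gsrc (act_snd j) = grng (ginv x).
Proof. by rewrite grng_inv. Qed.

Lemma translate_subproof (x : G) (j : AG) (h : gsrc x = gsrc (act_snd j)) :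
  gsrc (bproj (act_fst j)) = grng (gmul (translate_comp h)).
Proof. by rewrite grng_mul; exact: act_space_comp. Qed.

Definition translate (x : G) (j : AG) (h : gsrc x = gsrc (act_snd j)) : AG :=
  space_pt (a := act_fst j) (y := gmul (translate_comp h))
    (translate_subproof h).

Definition G_invariant (J : set AG) :=
  forall (x : G) (j : AG) (h : gsrc x = gsrc (act_snd j)),
    J j -> J (translate h).

Definition ideals : set (set A) := [set I | fell_ideal I].

Definition invariant_ideals : set (set AG) :=
  [set J | fell_ideal J /\ G_invariant J].

Definition ideal_action (I : set A) : set AG := [set j | I (act_fst j)].

End Invariant.

Section Lattice.
Variable T : Type.

Definition is_meet (L : set (set T)) (I J M : set T) :=
  [/\ L M, M `<=` I, M `<=` J &
      forall N, L N -> N `<=` I -> N `<=` J -> N `<=` M].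

Definition is_join (L : set (set T)) (I J M : set T) :=
  [/\ L M, I `<=` M, J `<=` M &
      forall N, L N -> I `<=` N -> J `<=` N -> M `<=` N].

Definition is_lattice (L : set (set T)) :=
  forall I J, L I -> L J -> (exists M, is_meet L I J M) /\
                            (exists M, is_join L I J M).

End Lattice.

Definition lattice_isomorphism (T U : Type) (L : set (set T)) (K : set (set U))
    (f : set T -> set U) :=
  [/\ is_lattice L, is_lattice K, set_bij L K f &
      forall I J M, L I -> L J ->
        (is_meet L I J M -> is_meet K (f I) (f J) (f M)) /\
        (is_join L I J M -> is_join K (f I) (f J) (f M))].

(* Main.v *)
Require Import Defs.
From mathcomp Require Import all_boot all_order all_algebra.
From mathcomp Require Import complex.
From mathcomp Require Import all_classical all_reals topology normedtype.

Set Implicit Arguments.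
Unset Strict Implicit.
Unset Printing Implicit Defensive.

Import Order.TTheory GRing.Theory Num.Theory.
Import numFieldNormedType.Exports.

Local Open Scope classical_set_scope.
Local Open Scope ring_scope.

(** The proof has three ingredients.

    Order theory. The map from ideals of A to invariant ideals of the action
    bundle is the inverse image under the surjection (a, y) |-> a, so it
    preserves and reflects inclusion.  Once it is known to be a bijection, it
    carries meets and joins to meets and joins, and the lattice property has
    to be checked only for the ideals of A.

    The ideals of A form a lattice. Any family of ideals has a supremum: over
    each x, take the closed linear span of all the fibres over x
    ([ideal_sup_ideal]).  It absorbs products because multiplication by a fixed
    element is a bounded linear map between fibres, and it is closed under the
    involution because the involution is isometric on fibres
    ([fstar_norm]).  The point is that the projection stays open, that is, that
    through every element of the span there pass nearby elements of the span
    over all nearby points.  The vectors with this property form a closed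
    subspace of each fibre, by the continuity of the bundle operations, and
    they include those of the given ideals ([ideal_sup_open]).  Meets are
    suprema of lower bounds; in this way one never has to show that the
    intersection of two ideals has an open projection, which would require
    approximate units.

    The bijection. By invariance, whether (a, y) belongs to an invariant ideal
    J depends on a alone, since y may be replaced by any arrow y' with the same
    range, acting by y'^-1 y ([invariant_fst]).  Hence J comes from
    I = {a | (a, s(p(a))) is in J}.  Openness of the projection passes from I to
    its image because a product neighbourhood of (a, y) can be
    treated in each factor separately, and from J to I because
    x |-> (x, s(x)) is continuous. *)

(** * Lattices of sets and order isomorphisms *)

(** The meet of two elements is obtained as the supremum of their lower
    bounds. *)
Lemma is_lattice_of_sup (T : Type) (L : set (set T)) :
  (forall F, F `<=` L -> exists M, [/\ L M, forall I, F I -> I `<=` M &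
     forall N, L N -> (forall I, F I -> I `<=` N) -> M `<=` N]) ->
  is_lattice L.
Proof.
move=> sup I J LI LJ; split.
  have [|M [LM ub lub]] := sup [set N | [/\ L N, N `<=` I & N `<=` J]].
    by move=> N [].
  exists M; split=> //.
  - by apply: lub => // N [].
  - by apply: lub => // N [].
  - by move=> N LN NI NJ; exact: ub.
have [|M [LM ub lub]] := sup [set N | N = I \/ N = J].
  by move=> N [->|->].
exists M; split=> //.
- by apply: ub; left.
- by apply: ub; right.
- by move=> N LN IN JN; apply: lub => // K [->|->].
Qed.

Lemma lattice_isomorphism_of_order (T U : Type) (L : set (set T))
    (K : set (set U)) (f : set T -> set U) :
  is_lattice L -> set_bij L K f ->
  (forall I J, L I -> L J -> I `<=` J <-> f I `<=` f J) ->
  lattice_isomorphism L K f.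
Proof.
move=> latL [fLK finj fsurj] ford.
have meetP I J M : L I -> L J -> is_meet L I J M -> is_meet K (f I) (f J) (f M).
  move=> LI LJ [LM MI MJ Mmax]; split; first exact: fLK.
  - by apply/ford.
  - by apply/ford.
  - by move=> _ /fsurj[N LN <-] /ford NI /ford NJ; apply/ford => //; apply: Mmax; auto.
have joinP I J M : L I -> L J -> is_join L I J M -> is_join K (f I) (f J) (f M).
  move=> LI LJ [LM MI MJ Mmin]; split; first exact: fLK.
  - by apply/ford.
  - by apply/ford.
  - by move=> _ /fsurj[N LN <-] /ford NI /ford NJ; apply/ford => //; apply: Mmin; auto.
split=> //; last by move=> I J M LI LJ; split; [exact: meetP|exact: joinP].
move=> _ _ /fsurj[I LI <-] /fsurj[J LJ <-].
have [[M MP] [M' MP']] := latL I J LI LJ.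
by split; [exists (f M); exact: meetP|exists (f M'); exact: joinP].
Qed.

(** * Closed linear spans *)

Definition closed_subspace (R : realType) (V : completeNormedModType R[i])
  (S : set V) := linear_subspace S /\ closed S.

Definition closed_span (R : realType) (V : completeNormedModType R[i])
  (S : set V) := smallest (@closed_subspace R V) S.

Lemma closed_spanP (R : realType) (V : completeNormedModType R[i]) (S : set V) :
  closed_subspace (closed_span S).
Proof.
split; last by apply: closed_bigI => X [[]].
split; first by move=> X [[[X0 _] _] _].
by move=> l u v Su Sv X SX; case: (SX) => -[[_ Xl] _] _; apply: Xl; [exact: Su|exact: Sv].
Qed.

Lemma closed_span_sub (R : realType) (V : completeNormedModType R[i])
    (S T : set V) :
  closed_subspace T -> S `<=` T -> closed_span S `<=` T.
Proof. exact: smallest_sub. Qed.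

(** The preimage of a closed subspace is a closed subspace.  The scalar twist
    [s] lets the lemma serve both for multiplications, with [s] the identity,
    and for the involution, with [s] the conjugation. *)
Lemma closed_span_map (R : realType) (V W : completeNormedModType R[i])
    (f : V -> W) (k : R[i]) (s : R[i] -> R[i]) (S : set V) (T : set W) :
  (forall l u v, f (l *: u + v) = s l *: f u + f v) ->
  0 <= k -> (forall u, `|f u| <= k * `|u|) ->
  (forall v, S v -> T (f v)) ->
  forall v, closed_span S v -> closed_span T (f v).
Proof.
move=> flin k_ge0 fbd fST; apply: closed_span_sub; last first.
  by move=> v Sv; apply: sub_gen_smallest; exact: fST.
have [[T0 Tl] Tcl] := closed_spanP T.
have fN0 : f 0 = 0 by apply/eqP; rewrite -normr_le0 (le_trans (fbd _))// normr0 mulr0.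
have fB u v : f (u - v) = f u - f v.
  (* [s 1] need not be [1], but it acts as [1] on the range of [f]. *)
  have f1 w : s 1 *: f w = f w.
    by rewrite -[RHS](congr1 f (scale1r w)) -[1 *: w]addr0 flin fN0 addr0.
  by apply/eqP; rewrite eq_sym subr_eq -{1}(f1 (u - v)) -flin scale1r subrK.
split; first split.
- by rewrite /= fN0.
- by move=> l u v Tu Tv; rewrite /= flin; exact: Tl.
- apply: preimage_closed Tcl => u _.
  have k1_gt0 : 0 < k + 1 by rewrite ltr_wpDl.
  apply/cvgrPdist_lt => e e0; near=> t.
  rewrite -fB (le_lt_trans (fbd _))// (@le_lt_trans _ _ ((k + 1) * `|u - t|))//.
    by rewrite ler_wpM2r// lerDl.
  rewrite -ltr_pdivlMl//; near: t.
  by apply: (@cvgr_dist_lt _ V) => //; rewrite mulr_gt0 ?invr_gt0.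
Unshelve. all: by end_near.
Qed.

(** * Fibrewise operations on the total space *)

Section Fibres.
Variables (R : realType) (X : topologicalType) (B : bundle R X).

(** [bvec (bpt v)] and [v] have types that are equal but not convertible; a
    property of all fibres moves from one to the other without a transport. *)
Lemma bvec_pt (P : forall x, bfib B x -> Prop) x (v : bfib B x) :
  P _ (bvec (bpt v)) <-> P x v.
Proof. by rewrite /bvec /bproj bel_pt. Qed.

Lemma bnorm_pt x (v : bfib B x) : bnorm (bpt v) = complex.Re `|v|.
Proof. by rewrite /bnorm /bvec /bproj bel_pt. Qed.

Lemma badd_pt x (v w : bfib B x) (h : bproj (bpt v) = bproj (bpt w)) :
  badd h = bpt (v + w).
Proof.
move: h; rewrite /badd /bvec /bproj !bel_pt /= => h.
by rewrite (eq_irrelevance h erefl).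
Qed.

Lemma bscale_pt l x (v : bfib B x) : bscale l (bpt v) = bpt (l *: v).
Proof. by rewrite /bscale /bvec /bproj bel_pt. Qed.

Lemma badd_bscale_pt l x (v w : bfib B x)
    (h : bproj (bscale l (bpt v)) = bproj (bpt w)) :
  badd h = bpt (l *: v + w).
Proof. by move: h; rewrite bscale_pt => h; exact: badd_pt. Qed.

Lemma bpt_over (b : B) x : bproj b = x -> exists v : bfib B x, b = bpt v.
Proof. by move=> <-; exists (bvec b); rewrite bpt_vec. Qed.

End Fibres.

Section FellFibres.
Variables (R : realType) (G : groupoid) (A : fell_data R G).

Lemma bmul_pt x y (h : gsrc x = grng y) (v : bfib A x) (w : bfib A y)
    (h' : gsrc (bproj (bpt v)) = grng (bproj (bpt w))) :
  bmul h' = bpt (fmul h v w).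
Proof.
move: h'; rewrite /bmul /bvec /bproj !bel_pt /= => h'.
by rewrite (eq_irrelevance h' h).
Qed.

Lemma bstar_pt x (v : bfib A x) : bstar (bpt v) = bpt (fstar v).
Proof. by rewrite /bstar /bvec /bproj bel_pt. Qed.

Lemma norm_bpt x y (v : bfib A x) (w : bfib A y) : bpt v = bpt w -> `|v| = `|w|.
Proof.
move=> e; have := congr1 (fun b => `|bvec b|) e.
by rewrite /= /bvec /bproj !bel_pt.
Qed.

Lemma norm_recast x y (e : x = y) (v : bfib A x) :
  `|recast (F := bfib A) e v| = `|v|.
Proof. by case: y / e. Qed.

Hypothesis FA : is_fell A.

(** [|v|^2 = |v^* v| <= |v^*| |v|]. *)
Lemma fstar_norm_ge x (v : bfib A x) : `|v| <= `|fstar v|.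
Proof.
have [->|v0] := eqVneq v 0; first by rewrite normr0.
rewrite -(ler_pM2r (_ : 0 < `|v|)) ?normr_gt0// -expr2.
have [_ r _ _ _ _] := fell_imprimitivity FA x.
by rewrite -(rh_norm r v) norm_recast; exact: fell_norm_mul.
Qed.

Lemma fstar_norm x (v : bfib A x) : `|fstar v| = `|v|.
Proof.
apply/eqP; rewrite eq_le fstar_norm_ge andbT.
by rewrite -[leRHS](norm_bpt (fell_starK FA v)) fstar_norm_ge.
Qed.

(** The fibres carry the topology of the total space or a finer one: near [v0],
    [v - v0] tends to the zero section by the axiom on its neighbourhoods, and
    adding [v0] is continuous. *)
Lemma bpt_continuous x : continuous (fun v : bfib A x => bpt v).
Proof.
have BA := fell_banach FA.
move=> v0.
have N0 : (fun v : bfib A x => bpt (v - v0)) @ v0 --> bzero A x.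
  apply: (@bs_zero_nbhs _ _ _ _ BA); first exact: (@filterT _ (nbhs v0)).
    have eproj : (fun v : bfib A x => bproj (bpt (v - v0))) = fun=> x.
      by apply/funext => v; exact: bproj_pt.
    change ((fun v : bfib A x => bproj (bpt (v - v0))) @ v0 --> x).
    by rewrite eproj; exact: cvg_cst.
  have enorm : (fun v : bfib A x => bnorm (bpt (v - v0))) =
      (fun v : bfib A x => complex.Re `|v - v0|).
    by apply/funext => v; exact: bnorm_pt.
  change ((fun v : bfib A x => bnorm (bpt (v - v0))) @ v0 --> (0 : R)).
  rewrite enorm.
  apply/cvgrPdist_lt => e e0; near=> v.
  have vR := RRe_real (normr_real (v - v0)).
  have Re0 : 0 <= complex.Re `|v - v0| by rewrite -lecR vR; exact: normr_ge0.
  rewrite sub0r normrN (ger0_norm Re0) -ltcR vR; near: v.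
  by apply: (@cvgr_distC_lt _ (bfib A x)) => //; rewrite ltcR.
pose S : set (A * A) := [set bc | ([set: A] bc.1 /\ [set: A] bc.2) /\
                                  bproj bc.1 = bproj bc.2].
have hS (v : bfib A x) : S (bpt (v - v0), bpt v0) by split => //=; rewrite !bproj_pt.
pose g (v : bfib A x) : S := exist _ (bpt (v - v0), bpt v0) (mem_set (hS v)).
have cg : g @ v0 --> g v0.
  have cg : (fun v => val (g v)) @ v0 --> val (g v0).
    by apply: cvg_pair; [rewrite /= subrr; exact: N0|exact: cvg_cst].
  move=> V [_ [[W oW <-] /= Wg]] /filterS; apply.
  by apply: cg; exact: open_nbhs_nbhs.
pose a (bc : S) : A := badd (proj2 (set_mem (valP bc))).
have ag v : a (g v) = bpt v.
  by rewrite /a badd_pt subrK.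
have : (a \o g) @ v0 --> a (g v0).
  apply: (cvg_comp _ _ cg); exact: (bs_add_continuous BA).
by rewrite ag (_ : a \o g = fun v => bpt v)//; apply/funext => v; exact: ag.
Unshelve. all: by end_near.
Qed.

(** * Recognizing ideals *)

(** Every other clause of a Banach subbundle is inherited from the ambient
    bundle, or follows from the zero vectors being in [S]; only the fibres being
    closed subspaces and the openness of the projection are conditions on [S]. *)
Lemma fell_ideal_intro (S : set A) :
  (forall x, closed_subspace [set v : bfib A x | S (bpt v)]) ->
  (forall x (v : bfib A x) (U : set A), S (bpt v) -> open U -> U (bpt v) ->
     nbhs x (bproj @` (S `&` U))) ->
  (forall b c (h : gsrc (bproj b) = grng (bproj c)), S b \/ S c -> S (bmul h)) ->
  (forall b, S b -> S (bstar b)) ->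
  fell_ideal S.
Proof.
have BA := fell_banach FA.
move=> Sfib Sopen Smul Sstar; split=> //; split=> //; last first.
  by move=> b c h Sb _; apply: Smul; left.
split.
- exact: Sfib.
- apply: continuous_subspaceT; exact: bproj_continuous FA.
- move=> U oU; rewrite openE => _ [b [Sb Ub] <-].
  by apply: Sopen (bvec b) _ _ _ _; rewrite ?bpt_vec.
- apply/seteqP; split=> // x _; exists (bzero A x); last exact: bproj_pt.
  by have [[]] := Sfib x.
- move=> e; have [U oU] := bs_norm_usc BA e; rewrite !setTI => eU.
  by exists U => //; rewrite eU.
- apply: (badd_continuous FA); [exact: val_fst_continuous|exact: val_snd_continuous].
- by move=> l; apply: continuous_subspaceT; exact: bscale_continuous FA l.
- by move=> N x PN _; apply: (bs_zero_nbhs BA); exact: filterT.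
Qed.

Lemma fell_ideal_open (I : set A) x (v : bfib A x) (U : set A) :
  fell_ideal I -> I (bpt v) -> open U -> U (bpt v) -> nbhs x (bproj @` (I `&` U)).
Proof.
move=> [[[_ _ Io _ _ _ _ _] _ _] _] Iv oU Uv; apply: open_nbhs_nbhs; split.
  exact: Io.
by exists (bpt v); rewrite ?bproj_pt.
Qed.

(** * Suprema of ideals *)

Definition ideal_sup (F : set (set A)) : set A :=
  [set b | closed_span [set v : bfib A (bproj b) | exists2 I, F I & I (bpt v)] (bvec b)].

Lemma ideal_supE F x (v : bfib A x) :
  ideal_sup F (bpt v) <->
  closed_span [set w : bfib A x | exists2 I, F I & I (bpt w)] v.
Proof.
exact: (bvec_pt (fun x v =>
  closed_span [set w : bfib A x | exists2 I, F I & I (bpt w)] v)).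
Qed.

Lemma ideal_sup_ub F I : F I -> I `<=` ideal_sup F.
Proof.
move=> FI b Ib; apply: sub_gen_smallest; exists I => //.
by rewrite bpt_vec.
Qed.

Lemma ideal_sup_lub F (N : set A) :
  fell_ideal N -> (forall I, F I -> I `<=` N) -> ideal_sup F `<=` N.
Proof.
move=> [[[Nfib _ _ _ _ _ _ _] _ _] _] FN b; rewrite -[b]bpt_vec ideal_supE.
apply: (closed_span_sub (Nfib _)) => v [I FI Iv]; exact: FN Iv.
Qed.

(** For a fixed base point, the set of vectors [v] such that every
    neighbourhood of [bpt v] meets the supremum over all nearby points is
    itself a closed subspace of the fibre, so it contains the closed span as
    soon as it contains the given ideals. *)
Lemma ideal_sup_open F x (v : bfib A x) (U : set A) :
  F `<=` [set I | fell_ideal I] ->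
  ideal_sup F (bpt v) -> open U -> U (bpt v) ->
  nbhs x (bproj @` (ideal_sup F `&` U)).
Proof.
move=> Fid + + +; rewrite ideal_supE => Sv; move: v Sv U.
apply: closed_span_sub; last first.
  move=> v [I FI Iv] U oU Uv.
  apply: filterS (fell_ideal_open (Fid _ FI) Iv oU Uv) => y [b [Ib Ub] <-].
  by exists b => //; split => //; exact: ideal_sup_ub Ib.
have sP y := closed_spanP [set w : bfib A y | exists2 I, F I & I (bpt w)].
split; first split.
(* Zero: the map [b |-> 0 b] is continuous and has values in the zero section. *)
- move=> U oU U0.
  have oV : open (bscale (B := A) 0 @^-1` U).
    by apply: open_comp oU => ? _; exact: bscale_continuous FA 0 _.
  apply: filterS (_ : nbhs x (bproj @` (setT `&` (bscale (B := A) 0 @^-1` U)))).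
    move=> y [b [_ Vb] <-]; exists (bscale 0 b); last exact: bproj_pt.
    by split=> //; apply/ideal_supE; rewrite scale0r; have [[]] := sP (bproj b).
  apply: open_nbhs_nbhs; split; first exact: (bs_proj_open (fell_banach FA)).
  by exists (bpt (0 : bfib A x)); [split=> //=; rewrite bscale_pt scale0r|exact: bproj_pt].
(* Combinations: [(b, c) |-> l b + c] is continuous on pairs over a common
   point, so nearby elements for [u] and [v] over the same point combine. *)
- move=> l u v Pu Pv U oU Uuv.
  pose S : set (A * A) := [set bc | bproj bc.1 = bproj bc.2].
  have h0 : S (bpt u, bpt v) by rewrite /S/= !bproj_pt.
  have hs (s : S) : bproj (bscale l (val s).1) = bproj (val s).2.
    by rewrite bproj_pt; exact: (set_mem (valP s)).
  have cS : continuous (fun s : S => badd (hs s)).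
    apply: (badd_continuous FA); last exact: val_snd_continuous.
    exact: (comp_continuous (bscale_continuous FA (l := l)) (@val_fst_continuous _ _ _)).
  have : nbhs (exist _ (bpt u, bpt v) (mem_set h0) : S) ((fun s : S => badd (hs s)) @^-1` U).
    apply: cS; apply: open_nbhs_nbhs; split => //=.
    by rewrite badd_bscale_pt.
  case=> _ [[W oW <-] /= Wuv sWU].
  have /= [[P Q] /= [Pbu Qbv] sPQ] : nbhs (bpt u, bpt v) W by exact: open_nbhs_nbhs.
  move: Pbu Qbv; rewrite (nbhsE (bpt u)) (nbhsE (bpt v)) => -[P' [oP' P'u sP']] [Q' [oQ' Q'v sQ']].
  have nu : nbhs x (bproj @` (ideal_sup F `&` P')) by exact: Pu.
  have nv : nbhs x (bproj @` (ideal_sup F `&` Q')) by exact: Pv.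
  apply: filterS (filterI nu nv) => y [[b [Mb P'b] /bpt_over[u' eb]] [c [Mc Q'c] /bpt_over[v' ec]]].
  subst b c; exists (bpt (l *: u' + v')); last exact: bproj_pt.
  split.
    by move: Mb Mc; rewrite !ideal_supE; have [[_ sl] _] := sP y; exact: sl.
  have hS : S (bpt u', bpt v') by rewrite /S/= !bproj_pt.
  pose s : S := exist _ (bpt u', bpt v') (mem_set hS).
  rewrite -(badd_bscale_pt (hs s)); apply: (sWU s).
  by apply: sPQ; split; [exact: sP'|exact: sQ'].
(* Limits: a vector close to [v] in the fibre already lies in [U]. *)
- move=> v clv U oU Uv.
  have : nbhs v [set w : bfib A x | U (bpt w)].
    by apply: bpt_continuous; exact: open_nbhs_nbhs.
  by move=> /clv[w [Pw Uw]]; exact: Pw.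
Qed.

Lemma ideal_sup_ideal F : F `<=` [set I | fell_ideal I] -> fell_ideal (ideal_sup F).
Proof.
move=> Fid; apply: fell_ideal_intro.
- move=> x; rewrite (_ : [set v | _] =
    closed_span [set w : bfib A x | exists2 I, F I & I (bpt w)]).
    exact: closed_spanP.
  by apply/seteqP; split=> v /ideal_supE.
- by move=> x v U; exact: ideal_sup_open.
- move=> b c; rewrite -[b]bpt_vec -[c]bpt_vec => h.
  have k := h; rewrite !bproj_pt in k; rewrite (bmul_pt k) !ideal_supE.
  have [bil1 bil2] := fell_mul_bilinear FA k.
  case.
    apply: (@closed_span_map _ _ _ (fun b => fmul k b (bvec c)) `|bvec c| id) => //.
      by move=> l u v; exact: bil1.
      by move=> u; rewrite mulrC; exact: fell_norm_mul.
    move=> v [I FI Iv]; exists I => //.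
    by rewrite -bmul_pt ?bproj_pt// => h'; apply: (fi_mul (Fid _ FI)); left.
  apply: (@closed_span_map _ _ _ (fun c => fmul k (bvec b) c) `|bvec b| id) => //.
    by move=> l u v; exact: bil2.
    by move=> u; exact: fell_norm_mul.
  move=> v [I FI Iv]; exists I => //.
  by rewrite -bmul_pt ?bproj_pt// => h'; apply: (fi_mul (Fid _ FI)); right.
- move=> b; rewrite -[b]bpt_vec bstar_pt !ideal_supE.
  apply: (@closed_span_map _ _ _ (fun b => fstar b) 1 (fun l => l^*)) => //.
  + exact: fell_star_linear FA _.
  + by move=> u; rewrite mul1r fstar_norm.
  + move=> v [I FI Iv]; exists I => //; rewrite -bstar_pt.
    by apply: (fs_star (fi_subbundle (Fid _ FI))).
Qed.

End FellFibres.

(** * Ideals of the action bundle *)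

Lemma ginvK (G : groupoid) (x : G) : ginv (ginv x) = x.
Proof.
have c1 : gsrc x = grng (ginv x) := comp_inv x.
have c2 : gsrc (ginv x) = grng (ginv (ginv x)) := comp_inv _.
have c12 : gsrc (gmul c1) = grng (ginv (ginv x)) by rewrite gsrc_mul.
have c21 : gsrc x = grng (gmul c2) by rewrite grng_mul.
have <- : gmul c12 = ginv (ginv x).
  rewrite -[RHS](gmul1g (comp_rng _)); apply: gmul_congr => //.
  by rewrite gmulgV !grng_inv gsrc_inv.
rewrite (gmulA c1 c2 c12 c21) -[RHS](gmulg1 (comp_src x)).
by apply: gmul_congr => //; rewrite gmulgV grng_inv.
Qed.

Section Action.
Variables (R : realType) (G : groupoid) (A : fellBundle R G).
Local Notation AG := (action_fell A).

Lemma act_space_ext (j k : AG) : act_fst j = act_fst k -> act_snd j = act_snd k ->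
  j = k.
Proof.
rewrite /act_fst /act_snd => e1 e2; apply: val_inj.
by rewrite [LHS]surjective_pairing e1 e2 -surjective_pairing.
Qed.

(** Translating [j = (a, y)] by [y] gives [(a, r(y))], and translating that by
    the inverse of [y'] gives [(a, y')]. *)
Lemma invariant_fst (J : set AG) (j k : AG) :
  G_invariant J -> act_fst j = act_fst k -> J j -> J k.
Proof.
move=> Jinv e Jj.
have h1 : gsrc (act_snd j) = gsrc (act_snd j) by [].
have J1 := Jinv _ _ h1 Jj.
have e1 : act_snd (translate h1) = gunit (grng (act_snd k)).
  rewrite -[LHS]/(gmul (translate_comp h1)) gmulgV -(act_space_comp j) e.
  by rewrite (act_space_comp k).
have h2 : gsrc (ginv (act_snd k)) = gsrc (act_snd (translate h1)).
  by rewrite e1 gsrc_inv gsrc_unit.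
have := Jinv _ _ h2 J1; congr J; apply: act_space_ext => //.
rewrite -[LHS]/(gmul (translate_comp h2)) -[RHS](gmul1g (comp_rng _)).
by apply: gmul_congr => //; exact: ginvK.
Qed.

Lemma ideal_action_invariant (I : set A) : G_invariant (ideal_action I).
Proof. by []. Qed.

(** Any arrow with range [s(p(a))] would do as second component; the unit makes
    the choice continuous in [a]. *)
Definition at_src (a : A) : AG := space_pt (comp_src (bproj a)).

Lemma ideal_actionS (I J : set A) :
  I `<=` J <-> ideal_action I `<=` ideal_action J.
Proof.
split=> [IJ j|IJ a Ia]; first exact: IJ.
exact: (IJ (at_src a)).
Qed.

Lemma ideal_action_ideal (I : set A) : fell_ideal I -> fell_ideal (ideal_action I).
Proof.
move=> Iid; have [[[Ifib _ _ _ _ _ _ _] _ Istar] Imul] := Iid.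
apply: fell_ideal_intro; first exact: fellP.
- by move=> z; exact: (Ifib (act1 z)).
- move=> z v U Iv [W oW <-] /= Wv.
  have /= [[P Q] /= [Pv Qv] sPQ] : nbhs (val (bpt v)) W by exact: open_nbhs_nbhs.
  move: Pv; rewrite nbhsE => -[P' [oP' P'v sP']].
  have n1 : nbhs z (@act1 G @^-1` (bproj @` (I `&` P'))).
    by apply: act1_continuous; exact: (fell_ideal_open Iid Iv).
  have n2 : nbhs z (@act2 G @^-1` Q) by exact: act2_continuous.
  apply: filterS (filterI n1 n2) => w [[a [Ia P'a] ea] Qw].
  have h : gsrc (bproj a) = grng (act2 w) by rewrite ea; exact: act_comp.
  exists (space_pt h); last exact: act_ext.
  by split => //; apply: sPQ; split => //; exact: sP'.
- move=> b c h Ibc; exact: (Imul _ _ (act_mul_comp1 h) Ibc).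
- by move=> b; exact: (Istar (act_fst b)).
Qed.

Definition ideal_restrict (J : set AG) : set A := [set a | J (at_src a)].

Lemma ideal_restrictE (J : set AG) (j : AG) :
  G_invariant J -> ideal_restrict J (act_fst j) <-> J j.
Proof. by move=> Jinv; split; exact: invariant_fst. Qed.

Lemma ideal_restrict_ideal (J : set AG) :
  fell_ideal J -> G_invariant J -> fell_ideal (ideal_restrict J).
Proof.
move=> Jid Jinv; have [[[Jfib _ _ _ _ _ _ _] _ Jstar] Jmul] := Jid.
have JE j := ideal_restrictE j Jinv.
apply: fell_ideal_intro; first exact: fellP.
- move=> x; rewrite (_ : [set v | _] =
      [set v : bfib AG (act_pt (comp_src x)) | J (bpt v)]).
    exact: Jfib.
  by apply/seteqP; split=> v /(JE (bpt (v : bfib AG (act_pt (comp_src x))))).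
- move=> x v U Jv oU Uv.
  pose z y : action_groupoid G := act_pt (comp_src y).
  have n : nbhs (z x) (bproj @` (J `&` (act_fst (A := A) @^-1` U))).
    apply: (fell_ideal_open (v := v : bfib AG (z x)) Jid).
    + exact/(JE (bpt (v : bfib AG (z x)))).
    + by apply: open_comp oU => ? _; exact: act_fst_continuous.
    + exact: Uv.
  have cz : continuous z.
    apply: act_pt_continuous; first by move=> ?; exact: cvg_id.
    exact: (comp_continuous (@gunit_continuous G) (@gsrc_continuous G)).
  have nx : nbhs x (z @^-1` (bproj @` (J `&` (act_fst (A := A) @^-1` U)))).
    exact: cz n.
  apply: filterS nx => y [j [Jj Uj] ej].
  exists (act_fst j); first by split=> //; exact/JE.
  exact: (congr1 (@act1 G) ej).
- move=> b c h Jbc.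
  (* [b] is paired with the range of the arrow below [at_src c], so that the
     product of the two pairs is defined. *)
  have hb : gsrc (bproj b) = grng (act_rng (bproj (at_src c))) by rewrite grng_mul.
  pose jb : AG := space_pt hb.
  have hm : gsrc (bproj jb) = grng (bproj (at_src c)) by [].
  rewrite (_ : bmul h = act_fst (bmul hm)); last first.
    by rewrite /bmul; congr (bpt (fmul _ _ _)); exact: eq_irrelevance.
  apply/JE/Jmul; case: Jbc => [/(JE jb)|]; by [left|right].
- move=> b Jb; apply: (proj2 (JE (bstar (at_src b)))); exact: Jstar.
Qed.

End Action.

Theorem theorem5p2 (R : realType) (G : groupoid) (A : fellBundle R G) :
  lattice_isomorphism (@ideals R G A) (@invariant_ideals R G A)
    (@ideal_action R G A).
Proof.
apply: lattice_isomorphism_of_order.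
- apply: is_lattice_of_sup => F Fid; exists (ideal_sup F); split.
  + exact: (ideal_sup_ideal (fellP A)).
  + by move=> I; exact: ideal_sup_ub.
  + by move=> N; exact: ideal_sup_lub.
- split.
  + move=> I Iid; split; first exact: ideal_action_ideal.
    exact: ideal_action_invariant.
  + move=> I J _ _ e; apply/seteqP.
    by split; apply/ideal_actionS; rewrite e.
  + move=> J [Jid Jinv]; exists (ideal_restrict J).
      exact: ideal_restrict_ideal.
    by apply/seteqP; split=> j /(ideal_restrictE j Jinv).
- by move=> I J _ _; exact: ideal_actionS.
Qed.
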